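(* Let $X\subset\mathbb P^3$ be a projective quartic surface defined by $F$, and let $P^0_4=R_4\big/\sum_{i,j=0}^3k\,x_i\,\dfrac{\partial F}{\partial x_j}$. If $\dim_kP^0_4\neq31$, then $19\le\dim_kP^0_4\le28$.
   Context: $k$ is an algebraically closed field of characteristic $0$, $R=k[x_0,x_1,x_2,x_3]$ with the standard grading, and $F\in R$ is homogeneous of degree $4$ containing $x_0^4$ as a summand (the coefficient of $x_0^4$ is $1$). $X=\operatorname{Proj}R/(F)$. $P^0_4$ is the degree-$4$ component of the graded ring $P^0=R/(\partial F/\partial x_0,\dots,\partial F/\partial x_3)$. *)

(* Defs.v *)
From HB Require Import structures.
From mathcomp Require Import all_boot all_order all_algebra.
From mathcomp Require Import mpoly.

Set Implicit Arguments.
Unset Strict Implicit.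
Unset Printing Implicit Defensive.

Import GRing.Theory.
Local Open Scope ring_scope.
Local Open Scope quotient_scope.

(* MathComp has quotients of Z-modules (and of commutative rings) but no       *)
(* quotient vector spaces: the quotient Z-module of V by the subspace U is     *)
(* equipped here with the scaling and the finite-dimensional structure induced *)
(* by V.                                                                       *)
Section QuotientSpace.
Import VectorInternalTheory.
Variables (K : fieldType) (V : vectType K) (U : {vspace V}).

Definition quotv : Type := Quotient.quot (pred_of_vspace U).

HB.instance Definition _ := GRing.Zmodule.on quotv.
HB.instance Definition _ := Quotient.on quotv.

Definition quotv_pi (v : V) : quotv := \pi_quotv v.

Lemma quotv_piP (v w : V) : reflect (quotv_pi v = quotv_pi w) (v - w \in U).
Proof.
rewrite (Quotient.idealrBE (pred_of_vspace U)).
exact: (iffP eqP).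
Qed.

Lemma quotv_reprK (q : quotv) : quotv_pi (repr q) = q.
Proof. exact: reprK. Qed.

Lemma quotv_repr_pi (v : V) : repr (quotv_pi v) - v \in U.
Proof. by apply/quotv_piP; rewrite quotv_reprK. Qed.

Lemma quotv_piD : {morph quotv_pi : v w / v + w}.
Proof. exact: (@raddfD _ _ (\pi_(Quotient.quot (pred_of_vspace U)))). Qed.

Definition quotv_scale (a : K) (q : quotv) : quotv := quotv_pi (a *: repr q).

Lemma quotv_scale_pi a v : quotv_scale a (quotv_pi v) = quotv_pi (a *: v).
Proof. by apply/quotv_piP; rewrite -scalerBr memvZ ?quotv_repr_pi. Qed.

Lemma quotv_scaleA a b q :
  quotv_scale a (quotv_scale b q) = quotv_scale (a * b) q.
Proof. by rewrite -[q]quotv_reprK !quotv_scale_pi scalerA. Qed.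

Lemma quotv_scale1 : left_id 1 quotv_scale.
Proof. by move=> q; rewrite -[q]quotv_reprK quotv_scale_pi scale1r. Qed.

Lemma quotv_scaleDr : right_distributive quotv_scale +%R.
Proof.
move=> a p q; rewrite -[p]quotv_reprK -[q]quotv_reprK.
by rewrite -quotv_piD !quotv_scale_pi scalerDr quotv_piD.
Qed.

Lemma quotv_scaleDl q : {morph quotv_scale^~ q : a b / a + b}.
Proof.
by move=> a b; rewrite -[q]quotv_reprK !quotv_scale_pi scalerDl quotv_piD.
Qed.

HB.instance Definition _ := GRing.Zmodule_isLmodule.Build K quotv
  quotv_scaleA quotv_scale1 quotv_scaleDr quotv_scaleDl.

Lemma quotv_pi_is_linear : linear quotv_pi.
Proof. by move=> a v w; rewrite quotv_piD -quotv_scale_pi. Qed.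

HB.instance Definition _ :=
  GRing.isLinear.Build K V quotv _ quotv_pi quotv_pi_is_linear.

Let projC := daddv_pi U^C U.

Let capUCU : (U^C :&: U = 0)%VS.
Proof. by rewrite capvC capv_compl. Qed.

Let projCD v : projC v + daddv_pi U U^C v = v.
Proof. by rewrite daddv_pi_add // addvC addv_complf memvf. Qed.

Let projC_eq0 v : v \in U -> projC v = 0.
Proof.
move=> vU; apply/eqP; rewrite -memv0 -capUCU memv_cap memv_pi /=.
by rewrite -[projC v](addrK (daddv_pi U U^C v)) projCD memvB ?memv_pi.
Qed.

Let projC_repr v : projC (repr (quotv_pi v)) = projC v.
Proof.
by apply/subr0_eq; rewrite -linearB; apply: projC_eq0 (quotv_repr_pi v).
Qed.

Lemma quotv_vect_iso : Vector.axiom (\dim {:V} - \dim U) quotv.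
Proof.
rewrite -dimv_compl.
pose f (q : quotv) := v2r (vsproj U^C (projC (repr q))).
exists f.
  have fP v : f (quotv_pi v) = v2r (vsproj U^C (projC v)).
    by rewrite /f projC_repr.
  move=> a p q; rewrite -[p]quotv_reprK -[q]quotv_reprK -linearP !fP.
  by rewrite !linearP.
exists (fun r => quotv_pi (vsval (r2v r))).
  move=> q; rewrite /f v2rK vsprojK ?memv_pi // -[RHS]quotv_reprK.
  apply/quotv_piP; rewrite -opprB rpredN -{1}[repr q]projCD addrC addKr.
  exact: memv_pi.
by move=> r; rewrite /f projC_repr daddv_pi_id ?subvsP // vsvalK r2vK.
Qed.

HB.instance Definition _ := Lmodule_hasFinDim.Build K quotv quotv_vect_iso.

Lemma dim_quotv : \dim {:quotv} = (\dim {:V} - \dim U)%N.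
Proof. by rewrite dimvf. Qed.

End QuotientSpace.

Section JacobianSpace.
Variables (n : nat) (k : fieldType) (d : nat).
Implicit Types (F : dhomog n.+1 k d) (i j : 'I_n.+1).

Lemma mulX_mderiv_homog F i j :
  'X_i * (mpoly_of_dhomog F)^`M(j) \is d.-homog.
Proof.
have homF := dhomog_is_dhomog F.
rewrite [X in X^`M(_)]mpolyE linear_sum /= mulr_sumr big_seq.
apply: rpred_sum => m /(dhomog_mf homF) degm.
rewrite mderivZ -scalerAr mderivX -scalerAr rpredZ //.
have [->|m_j] := eqVneq (m j) 0%N; first by rewrite scale0r rpred0.
rewrite rpredZ // -mpolyXD dhomogX /= mdegD mdeg1.
have /submK/(congr1 (@mdeg _)) : (U_(j) <= m)%MM by rewrite lep1mP.
by rewrite mdegD mdeg1 addnC degm => ->.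
Qed.

Definition mulX_mderiv F i j : dhomog n.+1 k d :=
  DHomog (mulX_mderiv_homog F i j).

Definition jacobian_space F : {vspace dhomog n.+1 k d} :=
  (\sum_(i < n.+1) \sum_(j < n.+1) <[mulX_mderiv F i j]>)%VS.

(* R = k[x_0, ..., x_n]: since the ideal (dF/dx_0, ..., dF/dx_n) is generated  *)
(* in degree d - 1, its component in degree d = deg F is the span of the       *)
(* products x_i * dF/dx_j, so that R_d / jacobian_space F is the component of  *)
(* degree d of the graded ring P^0 = R / (dF/dx_0, ..., dF/dx_n).              *)
Definition P0_comp F := quotv (jacobian_space F).

HB.instance Definition _ F := Vector.on (P0_comp F).

End JacobianSpace.

(* Main.v *)
Require Import Defs.
From mathcomp Require Import all_boot all_order all_algebra.
From mathcomp Require Import mpoly.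
From mathcomp Require Import zify.

Import GRing.Theory.
Local Open Scope ring_scope.

(** Write J for the span of the x_i dF/dx_j inside R_4, so that
    dim P^0_4 = 35 - dim J. There are 16 generators, whence the lower bound 19.
    For the upper bound it suffices that dim J is either 4 or at least 7.

    Let A = dF/dx_0; it is nonzero because in characteristic 0 its coefficient
    at x_0^3 is 4. If every partial derivative of F is a multiple of A, then J
    is spanned by the four independent products x_i A and dim J = 4, which is
    the excluded case (F is then the fourth power of a linear form). Otherwise
    some dF/dx_j is not a multiple of A, and subtracting a multiple of A from it
    gives a nonzero B whose leading monomial differs from that of A. Polynomials
    with distinct leading monomials are independent, and among the leading
    monomials lm(A) x_i and lm(B) x_i of the 4 + 4 products x_i A, x_i B only
    one coincidence lm(A) x_i' = lm(B) x_i is possible, since the quotient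
    lm(A) / lm(B) <> 1 determines i and i'. Hence dim J >= 4 + 4 - 1 = 7.

    The argument works for any number n + 1 of variables and any degree, and
    gives the dichotomy dim J = n + 1 or dim J >= 2 n + 1
    ([dim_jacobian_space_gap]). *)

(** * Dimension bounds from leading monomials *)

Section LeadingMonomials.
Variables (n : nat) (k : fieldType) (d : nat).
Implicit Types (U : {vspace dhomog n.+1 k d}) (A B : {mpoly k[n.+1]}).

(** In a vanishing linear combination, consider the largest leading monomial
    that occurs with a nonzero coefficient: no other term can cancel it. *)
Lemma mlead_inj_free (r : nat) (X : r.-tuple (dhomog n.+1 k d)) :
  (forall i : 'I_r, X`_i != 0) ->
  injective (fun i : 'I_r => mlead (mpoly_of_dhomog X`_i)) ->
  free X.
Proof.
move=> X0 inj; apply/freeP => c sumX0 i; apply/eqP; apply: contraT => ci.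
case: (@Order.TotalTheory.arg_maxP _ _ 'I_r i (fun i => c i != 0)
   (fun i : 'I_r => mlead (mpoly_of_dhomog X`_i)) ci) => j cj jmax.
have := congr1 (fun p : dhomog n.+1 k d =>
  (mpoly_of_dhomog p)@_(mlead (mpoly_of_dhomog X`_j))) sumX0.
rewrite /= raddf_sum /= raddf_sum /= (bigD1 j) //= big1 => [|l lj].
  rewrite addr0 mcoeffZ mcoeff0 => /eqP.
  rewrite mulf_eq0 (negPf cj) mleadc_eq0 (raddf_eq0 _ val_inj).
  by rewrite (negPf (X0 j)).
rewrite mcoeffZ; have [->|cl] := eqVneq (c l) 0; first by rewrite mul0r.
rewrite mcoeff_gt_mlead ?mulr0 // Order.POrderTheory.lt_neqAle.
rewrite [X in _ && X](jmax l cl) andbT.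
by apply: contraNneq lj => /inj->.
Qed.

Lemma dim_ge_card_mlead U (I : finType) (w : I -> dhomog n.+1 k d) :
  (forall i, w i \in U) -> (forall i, w i != 0) ->
  injective (fun i => mlead (mpoly_of_dhomog (w i))) ->
  (#|I| <= \dim U)%N.
Proof.
move=> wU w0 inj; pose X := [tuple w (enum_val i) | i < #|I|].
have nthX (i : 'I_#|I|) : X`_i = w (enum_val i).
  by rewrite -tnth_nth tnth_mktuple.
have freeX : free X.
  apply: mlead_inj_free => [i|i j]; rewrite !nthX //.
  by move=> /inj /enum_val_inj.
have /eqP dimX : \dim <<X>>%VS == #|I| by move: freeX; rewrite /free size_tuple.
rewrite -[X in (X <= _)%N]dimX; apply/dimvS/span_subvP => p.
by case/tnthP => i ->; rewrite tnth_mktuple.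
Qed.

(** If m' / m = x_i' / x_i = x_l' / x_l with m' / m <> 1, then both fractions
    are reduced, so [i = l]: at most one index [i0] has to be avoided. *)
Lemma mnm_collision (m m' : 'X_{1..n.+1}) : m != m' ->
  exists i0, forall i i', i != i0 -> (m + U_(i') != m' + U_(i))%MM.
Proof.
move=> mm'.
have [/existsP[i /existsP[i' /eqP e]]|none] :=
    boolP [exists i, exists i', (m + U_(i') == m' + U_(i))%MM]; last first.
  exists ord0 => i i' _; apply: contraNneq none => e.
  by apply/existsP; exists i; apply/existsP; exists i'; rewrite e.
exists i => l l'; apply: contraNneq => e'.
have ii' : i' != i.
  apply: contraNneq mm' => ii'; apply/eqP/(@addIm _ U_(i)%MM).
  by rewrite -{1}ii'.
have /mnmP/(_ i) := e; have /mnmP/(_ i) := e'.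
rewrite !mnmDE !mnm1E eqxx (negPf ii').
by case: (l =P i) => //= _; case: (l' =P i) => _ /=; lia.
Qed.

Lemma mpolyX_neq0 (m : 'X_{1..n.+1}) : 'X_[k, m] != 0.
Proof. by rewrite -msupp_eq0 msuppX. Qed.

Lemma mlead_mulX A i : A != 0 -> mlead ('X_i * A) = (mlead A + U_(i))%MM.
Proof. by move=> A0; rewrite mleadM ?mpolyX_neq0 // mleadXm addmC. Qed.

Lemma mulX_dhomog_neq0 A (w : dhomog n.+1 k d) i :
  A != 0 -> mpoly_of_dhomog w = 'X_i * A -> w != 0.
Proof.
move=> A0 wE; rewrite -(raddf_eq0 _ val_inj) /= wE.
by rewrite mulf_neq0 // mpolyX_neq0.
Qed.

Lemma addmU_inj (m : 'X_{1..n.+1}) : injective (fun i => m + U_(i))%MM.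
Proof.
move=> i j /addmI /mnmP/(_ i); rewrite !mnm1E eqxx.
by case: (j =P i).
Qed.

Section Products.
Variables (U : {vspace dhomog n.+1 k d}) (A B : {mpoly k[n.+1]}).
Variables u v : 'I_n.+1 -> dhomog n.+1 k d.
Hypotheses (A0 : A != 0) (uU : forall i, u i \in U)
  (uE : forall i, mpoly_of_dhomog (u i) = 'X_i * A).

Lemma dim_ge_mulX : (n.+1 <= \dim U)%N.
Proof.
rewrite -[X in (X <= _)%N]card_ord; apply: (dim_ge_card_mlead _ _ u) => //.
  by move=> i; apply: mulX_dhomog_neq0 (uE i).
by move=> i j; rewrite !uE !mlead_mulX // => /addmU_inj.
Qed.

Hypotheses (B0 : B != 0) (vU : forall i, v i \in U)
  (vE : forall i, mpoly_of_dhomog (v i) = 'X_i * B) (AB : mlead A != mlead B).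

(** The products x_i B with i <> i0 have leading monomials that differ from
    those of all x_i' A, so they contribute n dimensions beyond the n + 1 of
    the products x_i A. *)
Lemma dim_ge_mulX2 : (n.*2.+1 <= \dim U)%N.
Proof.
have [i0 i0P] := mnm_collision _ _ AB.
pose w (s : 'I_n.+1 + 'I_n) :=
  match s with inl i => u i | inr i => v (lift i0 i) end.
have -> : n.*2.+1 = #|{: 'I_n.+1 + 'I_n}|.
  by rewrite card_sum !card_ord addSn addnn.
have lift_i0 i : lift i0 i != i0 by rewrite eq_sym neq_lift.
apply: (dim_ge_card_mlead _ _ w).
- by case=> i /=.
- case=> i /=; first exact: mulX_dhomog_neq0 (uE i).
  exact: mulX_dhomog_neq0 (vE _).
- case=> i [] j /=; rewrite ?uE ?vE !mlead_mulX //.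
  + by move=> /addmU_inj->.
  + by move=> /eqP; rewrite (negPf (i0P _ _ _)).
  + by move=> /esym/eqP; rewrite (negPf (i0P _ _ _)).
  + by move=> /addmU_inj /lift_inj->.
Qed.

End Products.
End LeadingMonomials.

(** * The span of the products x_i dF/dx_j *)

Lemma dim_sum_lines_le (k : fieldType) (V : vectType k) (I : finType)
    (w : I -> V) : (\dim (\sum_i <[w i]>) <= #|I|)%N.
Proof.
apply: leq_trans (dimv_leq_sum _ _ _) _.
by rewrite -sum1_card; apply: leq_sum => i _; rewrite dim_vline leq_b1.
Qed.

Section Jacobian.
Variables (n : nat) (k : fieldType) (d : nat) (F : dhomog n.+1 k d).

Local Notation "'dF j" := ((mpoly_of_dhomog F)^`M(j)) (at level 10).

Lemma mulX_mderiv_jacobian i j : mulX_mderiv F i j \in jacobian_space F.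
Proof.
rewrite memvE /jacobian_space (bigD1 i) //=; apply: subv_trans (addvSl _ _).
by rewrite (bigD1 j) //= addvSl.
Qed.

Lemma dim_jacobian_space_le : (\dim (jacobian_space F) <= n.+1 * n.+1)%N.
Proof.
rewrite /jacobian_space pair_bigA /=.
apply: leq_trans (dim_sum_lines_le _ _ _ _) _.
by rewrite card_prod !card_ord.
Qed.

(** If all partial derivatives are multiples of the one at [j0], its n + 1
    products with the variables already span everything. Otherwise two
    independent partial derivatives can be combined to have distinct leading
    monomials, and [dim_ge_mulX2] applies. *)
Lemma dim_jacobian_space_gap (j0 : 'I_n.+1) : 'dF j0 != 0 ->
  \dim (jacobian_space F) = n.+1 \/ (n.*2.+1 <= \dim (jacobian_space F))%N.
Proof.
set A := 'dF j0 => A0; pose m := mlead A.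
pose c j := ('dF j)@_m / A@_m; pose B j := 'dF j - c j *: A.
have [/existsP[j Bj]|allprop] := boolP [exists j, B j != 0]; [right|left].
  apply: (@dim_ge_mulX2 _ _ _ _ A (B j) (fun i => mulX_mderiv F i j0)
    (fun i => mulX_mderiv F i j - c j *: mulX_mderiv F i j0)) => // [i|i|i|].
  - exact: mulX_mderiv_jacobian.
  - by rewrite memvB ?memvZ ?mulX_mderiv_jacobian.
  - by rewrite /= mulrBr scalerAr.
  - (* The scalar c j is chosen to cancel the coefficient of B j at lm(A). *)
    apply: contraNneq Bj; rewrite -mleadc_eq0 -/m => <-.
    by rewrite mcoeffB mcoeffZ divfK ?subrr // mleadc_eq0.
apply/eqP; rewrite eqn_leq; apply/andP; split; last first.
  apply: (@dim_ge_mulX _ _ _ _ A (fun i => mulX_mderiv F i j0)) => // i.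
  exact: mulX_mderiv_jacobian.
have dFE j : 'dF j = c j *: A.
  apply/subr0_eq/eqP; apply: contraNT allprop => Bj.
  by apply/existsP; exists j.
have subJ : (jacobian_space F <= \sum_(i < n.+1) <[mulX_mderiv F i j0]>)%VS.
  apply/subv_sumP => i _; apply/subv_sumP => j _; rewrite -memvE.
  have -> : mulX_mderiv F i j = c j *: mulX_mderiv F i j0.
    by apply: val_inj; rewrite /= dFE scalerAr.
  by rewrite memvZ // memvE (bigD1 i) //= addvSl.
apply: leq_trans (dimvS subJ) _.
by apply: leq_trans (dim_sum_lines_le _ _ _ _) _; rewrite card_ord.
Qed.

End Jacobian.

(** * Quartic surfaces *)

(* The surface X = Proj k[x_0, ..., x_3]/(F) enters only through its equation F. *)
Theorem lemma4p16 (k : closedFieldType) (k_char0 : [pchar k] =i pred0)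
    (F : dhomog 4 k 4)
    (F_x0 : (mpoly_of_dhomog F)@_(U_(ord0) *+ 4) = 1) :
  \dim {: P0_comp F} <> 31%N ->
  (19 <= \dim {: P0_comp F} <= 28)%N.
Proof.
have dF0 : (mpoly_of_dhomog F)^`M(ord0) != 0.
  apply: contra_eq_neq F_x0 => dF0.
  have /eqP := congr1 (mcoeff (U_(ord0) *+ 3)%MM) dF0.
  rewrite mcoeff_mderiv mcoeff0 -mulmSr.
  rewrite mulmnE mnm1E eqxx -mulr_natr mulf_eq0 ((pcharf0P k).1 k_char0) orbF.
  by move=> /eqP->; rewrite eq_sym oner_neq0.
have dimR4 : \dim {: dhomog 4 k 4} = 35%N by rewrite dimvf.
have dimP : \dim {: P0_comp F} = (35 - \dim (jacobian_space F))%N.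
  by rewrite -dimR4; exact: dim_quotv.
rewrite {}dimP; have := dim_jacobian_space_le _ _ _ F.
case: (dim_jacobian_space_gap _ _ _ F _ dF0) => [->//|]; lia.
Qed.
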